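(* Let $R$ be a ring and let $\mathbb{X}=\mathsf{Add}\,\mathbb{X}$ be a class of left $R$-modules. Assume that every finitely presented left $R$-module $M$ has a right $\mathbb{X}$-resolution $X(M)$. Then $$\mathcal{G}_{\mathbb{X}}=\big\{\Sigma^nX(M)\,\big|\,M\in\mathsf{mod}\,R,\ n\in\mathbb{Z}\big\}$$ is a set of compact objects in $\mathsf{K}(\mathbb{X})$. Furthermore, $\mathcal{G}_{\mathbb{X}}$ generates $\mathsf{K}(\mathbb{X})$ (that is, $\mathcal{G}_{\mathbb{X}}$ is a generating set of $\mathsf{K}(\mathbb{X})$) if and only if every pure exact sequence in $\mathsf{Mod}\,R$ consisting of modules from $\mathbb{X}$ is split exact.
   Context: $R$ is an associative ring; modules are left $R$-modules. $\mathsf{Mod}\,R$ is the category of all modules and $\mathsf{mod}\,R$ the category of finitely presented modules. For a class $\mathbb{A}$ of modules, $\mathsf{Add}\,\mathbb{A}$ is the class of modules isomorphic to a direct summand of a coproduct $\coprod_{i\in I}A_i$ with $A_i\in\mathbb{A}$ and $I$ an arbitrary set. $\mathsf{K}(\mathbb{X})$ is the homotopy category: its objects are ($\mathbb{Z}$-indexed, unbounded) chain complexes of modules from $\mathbb{X}$ and its morphisms are chain maps modulo homotopy. It is triangulated with set-indexed coproducts; $\Sigma^n$ denotes the $n$-fold shift, $(\Sigma^nX)_t=X_{t-n}$ with differential $(-1)^n\partial^X_{t-n}$. Let $\mathsf{T}$ be a triangulated category with set-indexed coproducts. An object $C$ is compact if the natural map $\coprod_i\operatorname{Hom}_{\mathsf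 T}(C,X_i)\to\operatorname{Hom}_{\mathsf T}(C,\coprod_iX_i)$ is an isomorphism for every family $\{X_i\}_{i\in I}$. A set $\mathcal{G}$ of objects is a generating set if, for every $X\in\mathsf{T}$, $\operatorname{Hom}_{\mathsf T}(G,X)=0$ for all $G\in\mathcal{G}$ implies $X\cong0$. An $\mathbb{A}$-preenvelope of a module $M$ is a homomorphism $\varphi\colon M\to A$ with $A\in\mathbb{A}$ such that every homomorphism $M\to A'$ with $A'\in\mathbb{A}$ factors (not necessarily uniquely) through $\varphi$. If $\varphi^0\colon M\to A^0$ is an $\mathbb{A}$-preenvelope, $\varphi^1\colon\operatorname{Coker}\varphi^0\to A^1$ is an $\mathbb{A}$-preenvelope, $\varphi^2\colon\operatorname{Coker}\varphi^1\to A^2$ is an $\mathbb{A}$-preenvelope, and so on, then the complex $A(M)=\ 0\to A^0\to A^1\to A^2\to\cdots$ with differentials $A^n\twoheadrightarrow\operatorname{Coker}\varphi^n\xrightarrow{\varphi^{n+1}}A^{n+1}$ is called a right $\mathbb{A}$-resolution of $M$ ($A^0$ sits in degree $0$ and $A^n$ in homological degree $-n$). It is unique up to homotopy equivalence. A (not necessarily short) sequence $Y$ of modules is pure exact if $\operatorname{Hom}_R(M,Y)$ is exact for all finitely presented $M$. In the definition of $\mathcal{G}_{\mathbb{X}}$, $M$ is understood to run over a set of representatives of the isomorphism classes in $\mathsf{mod}\,R$. *)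

(* Defs.v *)
From HB Require Import structures.
From mathcomp Require Import all_boot all_order all_algebra.
From mathcomp Require Import ring_quotient generic_quotient.
From mathcomp Require Import mathcomp_extra boolp classical_sets cardinality fsbigop.

Set Implicit Arguments.
Unset Strict Implicit.
Unset Printing Implicit Defensive.

Import GRing.Theory.
Local Open Scope ring_scope.
Local Open Scope classical_set_scope.

(* A preadditive category; composition is in applicative order. *)
Record preadditive := Preadditive {
  ob :> Type;
  hom : ob -> ob -> zmodType;
  idm : forall A, hom A A;
  cmp : forall A B C, hom B C -> hom A B -> hom A C;
  cmp1m : forall A B (f : hom A B), cmp (idm B) f = f;
  cmpm1 : forall A B (f : hom A B), cmp f (idm A) = f;
  cmpA : forall A B C D (h : hom C D) (g : hom B C) (f : hom A B),
    cmp h (cmp g f) = cmp (cmp h g) f;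
  cmpDl : forall A B C (g g' : hom B C) (f : hom A B),
    cmp (g + g') f = cmp g f + cmp g' f;
  cmpDr : forall A B C (g : hom B C) (f f' : hom A B),
    cmp g (f + f') = cmp g f + cmp g f'
}.

Section Categories.
Variable T : preadditive.

(* Throughout, "set" is rendered by [choiceType], the sort in which the carriers
   of modules live; e.g. [lmodType R] itself is too large to be one. *)
Definition is_coproduct (I : choiceType) (A : I -> T) (S : T)
    (inj : forall i, hom (A i) S) : Prop :=
  forall (B : T) (f : forall i, hom (A i) B),
    exists! g : hom S B, forall i, cmp g (inj i) = f i.

(* An element of the direct sum of the groups [hom C (A i)] is a family of
   morphisms with finite support; the natural map sends it to the sum of the
   [cmp (inj i) (f i)]. *)
Definition compact (C : T) : Prop :=
  forall (I : choiceType) (A : I -> T) (S : T) (inj : forall i, hom (A i) S),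
    is_coproduct inj ->
    forall u : hom C S, exists! f : forall i, hom C (A i),
      finite_set [set i | f i != 0] /\
      \sum_(i \in [set: I]) cmp (inj i) (f i) = u.

Definition is_zero (A : T) : Prop :=
  forall B, (forall f g : hom A B, f = g) /\ (forall f g : hom B A, f = g).

Definition generates (G : T -> Prop) : Prop :=
  forall A, (forall B, G B -> forall f : hom B A, f = 0) -> is_zero A.

End Categories.

Section Modules.
Variable R : pzRingType.
Implicit Types (X : lmodType R -> Prop) (M N A : lmodType R).

Definition isomorphic M N : Prop :=
  exists (f : {linear M -> N}) (g : {linear N -> M}), cancel f g /\ cancel g f.

Definition is_direct_sum (I : choiceType) (A : I -> lmodType R) (S : lmodType R)
    (inj : forall i, {linear A i -> S}) : Prop :=
  forall (N : lmodType R) (f : forall i, {linear A i -> N}),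
    exists g : {linear S -> N},
      (forall i x, g (inj i x) = f i x) /\
      (forall g' : {linear S -> N}, (forall i x, g' (inj i x) = f i x) -> g' =1 g).

Definition Add X M : Prop :=
  exists (I : choiceType) (A : I -> lmodType R) (S : lmodType R)
         (inj : forall i, {linear A i -> S}) (N : lmodType R),
    [/\ forall i, X (A i), is_direct_sum inj & isomorphic (M * N)%type S].

Definition finitely_presented M : Prop :=
  exists (m n : nat) (q : {linear 'rV[R]_m -> 'rV[R]_n}) (p : {linear 'rV[R]_n -> M}),
    (forall y, exists x, p x = y) /\ (forall x, p x = 0 <-> exists z, q z = x).

Definition is_preenvelope X M A (phi : {linear M -> A}) : Prop :=
  X A /\
  forall A' (f : {linear M -> A'}), X A' ->
    exists g : {linear A -> A'}, forall x, g (phi x) = f x.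

Definition is_cokernel M N (C : lmodType R) (f : {linear M -> N}) (p : {linear N -> C}) : Prop :=
  (forall c, exists y, p y = c) /\ (forall y, p y = 0 <-> exists x, f x = y).

(* The differential is given for every pair of degrees and required to vanish
   unless the degrees are [j + 1] and [j]; thus no transport between modules
   such as [cterm (i - 1 - n)] and [cterm (i - n - 1)] is ever needed. *)
Record complex := Complex {
  cterm :> int -> lmodType R;
  diff : forall i j, {linear cterm i -> cterm j};
  diff_shape : forall i j, i != j + 1 -> forall x, diff i j x = 0;
  diff_diff : forall i j k x, diff j k (diff i j x) = 0
}.

Section Shift.
Variables (n : int) (Y : complex).

Definition shift_diff (i j : int) (x : Y (i - n)) : Y (j - n) :=
  diff Y (i - n) (j - n) x *~ ((-1) ^ n).

Fact shift_diff_linear i j : linear (@shift_diff i j).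
Proof. by move=> a x y; rewrite /shift_diff linearP mulrzDl scalerMzr. Qed.

HB.instance Definition _ i j :=
  GRing.isLinear.Build R (Y (i - n)) (Y (j - n)) _ (@shift_diff i j)
    (@shift_diff_linear i j).

Fact shift_shape i j : i != j + 1 -> forall x, @shift_diff i j x = 0.
Proof.
move=> ij x; rewrite /shift_diff diff_shape ?mul0rz//.
by apply: contra ij => /eqP e; rewrite -(subrK n i) e addrAC subrK.
Qed.

Fact shift_diff_diff i j k x : @shift_diff j k (@shift_diff i j x) = 0.
Proof. by rewrite /shift_diff raddfMz /= diff_diff !mul0rz. Qed.

Definition shift : complex :=
  @Complex (fun i => Y (i - n)) (fun i j => @shift_diff i j)
    shift_shape shift_diff_diff.
End Shift.

(* [phi0 : M -> Y_0] and [phi n : C n -> Y_(-(n+1))] are the successive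
   preenvelopes, where [p n : Y_(-n) -> C n] is the cokernel of the n-th one. *)
Definition is_right_resolution X M (Y : complex) : Prop :=
  (forall i : int, 0 < i -> forall x : Y i, x = 0) /\
  exists (C : nat -> lmodType R)
         (phi0 : {linear M -> Y (- 0%:Z)})
         (phi : forall n, {linear C n -> Y (- n.+1%:Z)})
         (p : forall n, {linear Y (- n%:Z) -> C n}),
    [/\ is_preenvelope X phi0 /\ (forall n, is_preenvelope X (phi n)),
        is_cokernel phi0 (p 0%N) /\ (forall n, is_cokernel (phi n) (p n.+1))
      & forall n x, diff Y (- n%:Z) (- n.+1%:Z) x = phi n (p n x)].

Definition is_exact (Y : complex) : Prop :=
  forall i (y : Y i), diff Y i (i - 1) y = 0 ->
    exists z : Y (i + 1), diff Y (i + 1) i z = y.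

Definition pure_exact (Y : complex) : Prop :=
  forall M, finitely_presented M ->
  forall i (f : {linear M -> Y i}), (forall x, diff Y i (i - 1) (f x) = 0) ->
    exists g : {linear M -> Y (i + 1)}, forall x, diff Y (i + 1) i (g x) = f x.

(* For exact [Y], the second condition says that the module of cycles is a
   direct summand of [Y i] (it is the image of the idempotent [p]), i.e. that
   the short exact sequence 0 -> Z_i -> Y_i -> Z_(i-1) -> 0 splits. *)
Definition split_exact (Y : complex) : Prop :=
  is_exact Y /\
  forall i, exists p : {linear Y i -> Y i},
    (forall y, diff Y i (i - 1) (p y) = 0) /\
    (forall y, diff Y i (i - 1) y = 0 -> p y = y).

End Modules.

Section ChainMaps.
Variable R : pzRingType.

Record chain_map (Y Z : complex R) := ChainMap {
  cmap :> forall i, {linear Y i -> Z i};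
  cmap_diff : forall i j x, cmap j (diff Y i j x) = diff Z i j (cmap i x)
}.

Lemma linear_ext (U V : lmodType R) (f g : {linear U -> V}) : f =1 g -> f = g.
Proof.
case: f g => f [[a1] [b1]] [g [[a2] [b2]]] /= /funext e.
case: _ / e in a2 b2 *.
by rewrite (Prop_irrelevance a1 a2) (Prop_irrelevance b1 b2).
Qed.

Lemma chain_map_ext Y Z (f g : chain_map Y Z) : (forall i, f i =1 g i) -> f = g.
Proof.
case: f g => f fd [g gd] /= e.
have fg : f = g by apply: functional_extensionality_dep => i; exact/linear_ext/e.
by case: _ / fg in gd e *; rewrite (Prop_irrelevance fd gd).
Qed.

Section Zmod.
Variables Y Z : complex R.

HB.instance Definition _ := gen_eqMixin (chain_map Y Z).
HB.instance Definition _ := gen_choiceMixin (chain_map Y Z).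

Program Definition cm0 : chain_map Y Z := @ChainMap Y Z (fun i => \0) _.
Next Obligation. by rewrite /= linear0. Qed.
Program Definition cm_opp (f : chain_map Y Z) : chain_map Y Z :=
  @ChainMap Y Z (fun i => \- f i) _.
Next Obligation. by rewrite /= linearN cmap_diff. Qed.
Program Definition cm_add (f g : chain_map Y Z) : chain_map Y Z :=
  @ChainMap Y Z (fun i => f i \+ g i) _.
Next Obligation. by rewrite /= linearD !cmap_diff. Qed.

Fact cm_addA : associative cm_add.
Proof. by move=> f g h; apply: chain_map_ext => i x /=; rewrite addrA. Qed.
Fact cm_addC : commutative cm_add.
Proof. by move=> f g; apply: chain_map_ext => i x /=; rewrite addrC. Qed.
Fact cm_add0 : left_id cm0 cm_add.
Proof. by move=> f; apply: chain_map_ext => i x /=; rewrite add0r. Qed.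
Fact cm_addN : left_inverse cm0 cm_opp cm_add.
Proof. by move=> f; apply: chain_map_ext => i x /=; rewrite addNr. Qed.

HB.instance Definition _ := GRing.isZmodule.Build (chain_map Y Z)
  cm_addA cm_addC cm_add0 cm_addN.

Definition null_homotopic : {pred chain_map Y Z} := fun f =>
  `[< exists h : forall i j, {linear Y i -> Z j}, forall i x,
        f i x = diff Z (i + 1) i (h i (i + 1) x) + h (i - 1) i (diff Y i (i - 1) x) >].

Lemma null_homotopicP (f : chain_map Y Z) :
  reflect (exists h : forall i j, {linear Y i -> Z j}, forall i x,
    f i x = diff Z (i + 1) i (h i (i + 1) x) + h (i - 1) i (diff Y i (i - 1) x))
  (f \in null_homotopic).
Proof. exact: asboolP. Qed.

Fact null_homotopic_zmod : zmod_closed null_homotopic.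
Proof.
split.
  by apply/null_homotopicP; exists (fun i j => \0) => i x /=; rewrite linear0 addr0.
move=> f g /null_homotopicP[h fh] /null_homotopicP[k gk].
apply/null_homotopicP; exists (fun i j => h i j \- k i j) => i x /=.
by rewrite linearB/= fh gk opprD addrACA.
Qed.

HB.instance Definition _ :=
  GRing.isZmodClosed.Build (chain_map Y Z) null_homotopic null_homotopic_zmod.

Definition hmap : zmodType := Quotient.quot null_homotopic.

Definition hclass (f : chain_map Y Z) : hmap := (\pi_(Quotient.quot null_homotopic) f)%qT.

Lemma hclassP (f g : chain_map Y Z) : hclass f = hclass g <-> f - g \in null_homotopic.
Proof.
rewrite Quotient.idealrBE.
by split=> [/eqP //|/eqP].
Qed.

Lemma hclass_surj (u : hmap) : exists f, u = hclass f.
Proof. by exists (repr u); rewrite /hclass reprK. Qed.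
End Zmod.

Program Definition cm_id (Y : complex R) : chain_map Y Y :=
  @ChainMap Y Y (fun i => idfun) _.

Program Definition cm_comp (Y Z W : complex R) (g : chain_map Z W) (f : chain_map Y Z)
  : chain_map Y W := @ChainMap Y W (fun i => g i \o f i) _.
Next Obligation. by rewrite /= !cmap_diff. Qed.
End ChainMaps.

Section HomotopyCategory.
Variables (R : pzRingType) (X : lmodType R -> Prop).

Record Kob := KOb { kcomplex :> complex R; kterm : forall i, X (kcomplex i) }.

Definition Khom (Y Z : Kob) : zmodType := hmap Y Z.
Definition Kid (Y : Kob) : Khom Y Y := hclass (cm_id Y).
(* See [hclass_cmp] below for the independence of representatives. *)
Definition Kcmp (Y Z W : Kob) (g : Khom Z W) (f : Khom Y Z) : Khom Y W :=
  hclass (cm_comp (repr g) (repr f)).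

Lemma hclass_cmp (Y Z W : Kob) (g : chain_map Z W) (f : chain_map Y Z) :
  Kcmp (hclass g : Khom Z W) (hclass f : Khom Y Z) = hclass (cm_comp g f).
Proof.
rewrite /Kcmp; set g' := repr _; set f' := repr _.
have /hclassP/null_homotopicP[h hP] : hclass g' = hclass g by rewrite /hclass reprK.
have /hclassP/null_homotopicP[k kP] : hclass f' = hclass f by rewrite /hclass reprK.
apply/hclassP/null_homotopicP.
exists (fun i j => (h i j \o f' i) \+ (g j \o k i j)) => i x /=.
have -> : g' i (f' i x) - g i (f i x) =
    (g' i (f' i x) - g i (f' i x)) + g i (f' i x - f i x).
  by rewrite linearB/= addrA subrK.
have /= -> := hP i (f' i x); have /= -> := kP i x.
by rewrite !linearD/= !cmap_diff addrACA.
Qed.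

Lemma hclassD (Y Z : complex R) (f g : chain_map Y Z) :
  hclass (f + g) = hclass f + hclass g.
Proof. by rewrite /hclass; rewrite raddfD. Qed.

Fact Kcmp1m Y Z (f : Khom Y Z) : Kcmp (Kid Z) f = f.
Proof.
have [f' ->] := hclass_surj f; rewrite hclass_cmp.
by congr hclass; apply: chain_map_ext.
Qed.
Fact Kcmpm1 Y Z (f : Khom Y Z) : Kcmp f (Kid Y) = f.
Proof.
have [f' ->] := hclass_surj f; rewrite hclass_cmp.
by congr hclass; apply: chain_map_ext.
Qed.
Fact KcmpA Y Z W V (h : Khom W V) (g : Khom Z W) (f : Khom Y Z) :
  Kcmp h (Kcmp g f) = Kcmp (Kcmp h g) f.
Proof.
have [f' ->] := hclass_surj f; have [g' ->] := hclass_surj g.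
have [h' ->] := hclass_surj h; rewrite !hclass_cmp.
by congr hclass; apply: chain_map_ext.
Qed.
Fact KcmpDl Y Z W (g g' : Khom Z W) (f : Khom Y Z) :
  Kcmp (g + g') f = Kcmp g f + Kcmp g' f.
Proof.
have [f1 ->] := hclass_surj f; have [g1 ->] := hclass_surj g.
have [g2 ->] := hclass_surj g'; rewrite -hclassD !hclass_cmp -hclassD.
by congr hclass; apply: chain_map_ext.
Qed.
Fact KcmpDr Y Z W (g : Khom Z W) (f f' : Khom Y Z) :
  Kcmp g (f + f') = Kcmp g f + Kcmp g f'.
Proof.
have [f1 ->] := hclass_surj f; have [g1 ->] := hclass_surj g.
have [f2 ->] := hclass_surj f'; rewrite -hclassD !hclass_cmp -hclassD.
by congr hclass; apply: chain_map_ext => i x /=; rewrite linearD.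
Qed.

Definition K : preadditive :=
  Preadditive Kcmp1m Kcmpm1 KcmpA KcmpDl KcmpDr.

Definition Kshift (n : int) (Y : K) : K :=
  @KOb (shift n Y) (fun i => @kterm Y (i - n)).

(* [rep] enumerates a set of representatives of the isomorphism classes of
   finitely presented modules. *)
Definition fp_representatives (J : choiceType) (rep : J -> lmodType R) : Prop :=
  (forall j, finitely_presented (rep j)) /\
  (forall M, finitely_presented M -> exists! j, isomorphic M (rep j)).

Definition generators (J : choiceType) (rep : J -> lmodType R)
    (res : lmodType R -> K) (C : K) : Prop :=
  exists j n, C = Kshift n (res (rep j)).

End HomotopyCategory.

(* Main.v *)
From HB Require Import structures.
From mathcomp Require Import all_boot all_order all_algebra.
From mathcomp Require Import generic_quotient finmap zify.
From mathcomp Require Import boolp classical_sets cardinality fsbigop.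
Require Import Defs.

Set Implicit Arguments.
Unset Strict Implicit.
Unset Printing Implicit Defensive.

Import Order.TTheory GRing.Theory Num.Theory.
Local Open Scope ring_scope.
Local Open Scope classical_set_scope.

(** Write [C] for the [n]-fold shift of a right [X]-resolution of [M]. It comes
    with [eta : M -> C n], and the defining property of preenvelopes says that
    [Hom(-, A)] turns [M -> C n -> C (n - 1) -> ...] into an exact complex for
    every [A] in [X]. Hence, for a complex [Y] with terms in [X], the map
    [F |-> F n \o eta] identifies homotopy classes of chain maps [C -> Y] with the
    homology of [Hom(M, Y)] in degree [n]: every cycle extends to a chain map
    ([coresolution_extend_cycle]), and a chain map is null-homotopic exactly when
    its cycle is a boundary ([coresolution_null_homotopic]).

    Compactness ([coresolution_compact]): a finitely presented [M] is finitely
    generated, so a morphism from [M] to a direct sum lands in a finite subsum,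
    and homotopy classes [C -> S] are determined by their restriction to [M].
    A coproduct in the homotopy category is only known through its universal
    property; it is a retract of the termwise direct sum of the complexes, which
    has terms in [X] because [X] is closed under direct sums, and the finite
    decomposition found there is carried back along the retraction.

    Generation: by the identification above, [Y] is orthogonal to all the
    generators exactly when [Hom(M, Y)] is exact for every finitely presented [M],
    that is, when [Y] is pure exact. On the other hand [Y] is a zero object exactly
    when its identity is null-homotopic, that is, when [Y] is split exact
    ([contractible_split_exact], [split_exact_contractible]). *)

(** * Recursion on integer degrees *)

(** [Q k F] stands for an equation between the components of [F] in degrees at
    least [k], and a solution is built one degree at a time, going down from [n].
    The unknown is a family over all of [int], changed at a single index by
    [dfwith]; recursing on the distance to [n] instead would force transports
    between modules such as [Y (n - m - 1)] and [Y (n - m.+1)]. *)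
Lemma downward_extension (T : int -> Type) (Q : int -> (forall i, T i) -> Prop)
    (n : int) (F0 : forall i, T i) :
  (forall k F F', (forall i, k <= i -> F i = F' i) -> Q k F -> Q k F') ->
  (forall k, n <= k -> Q k F0) ->
  (forall k F, k < n -> (forall i, n <= i -> F i = F0 i) ->
     (forall j, k < j -> Q j F) -> exists x : T k, Q k (dfwith F x)) ->
  exists F, (forall k, Q k F) /\ (forall i, n <= i -> F i = F0 i).
Proof.
move=> Qloc Q0 Qstep.
pose P (m : nat) (F : forall i, T i) :=
  (forall j, n - m%:Z <= j -> Q j F) /\ (forall i, n <= i -> F i = F0 i).
have /choice[step stepP] (mF : nat * (forall i, T i)) : exists F',
    P mF.1 mF.2 -> P mF.1.+1 F' /\ (forall i, n - mF.1%:Z <= i -> F' i = mF.2 i).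
  case: mF => m F /=; have [[QF FF0]|?] := pselect (P m F); last by exists F.
  pose k := n - m.+1%:Z.
  have [|j kj|x Qx] := Qstep k F _ FF0; [by lia|by apply: QF; lia|].
  have agree i : n - m%:Z <= i -> dfwith F x i = F i.
    by move=> mi; rewrite dfwith_out//; apply/eqP; lia.
  exists (dfwith F x) => _; split=> //; split=> [j mj|i ni]; last first.
    by rewrite agree ?FF0//; lia.
  have [<- //|jk] := eqVneq k j.
  by apply: (Qloc j F) => [i ji|]; [rewrite agree//; lia|apply: QF; lia].
pose G := fix G m := if m is m'.+1 then step (m', G m') else F0.
have GP m : P m (G m).
  elim: m => [|m IH]; first by split=> // j; rewrite subr0; apply: Q0.
  by have [] := stepP (m, G m) IH.
have Gstable m d i : n - m%:Z <= i -> G (m + d)%N i = G m i.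
  move=> mi; elim: d => [|d IH]; first by rewrite addn0.
  have [_ agree] := stepP ((m + d)%N, G (m + d)%N) (GP _).
  by rewrite addnS -IH; apply: agree => /=; lia.
(* The stages agree in degree [i] from stage [n - i] on; above [n] all of them
   equal [F0], so the absolute value is harmless there. *)
pose F i := G `|n - i|%N i.
have FG m i : n - m%:Z <= i -> F i = G m i.
  move=> mi; rewrite -(Gstable m `|n - i|%N)// addnC Gstable//; lia.
exists F; split=> [k|i ni]; last by rewrite (FG 0%N) ?subr0.
apply: (Qloc k (G `|n - k|%N)) => [i ki|]; first by rewrite (FG `|n - k|%N)//; lia.
by have [+ _] := GP `|n - k|%N; apply; lia.
Qed.

(** * Construction of linear maps *)

Section Linear.
Variable R : pzRingType.
Implicit Types (M N A U V : lmodType R).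

(** Since [L] is stable under linear combinations, the condition at [0] makes it
    single-valued, so any choice of values is linear. *)
Lemma linear_unique_choice U V (L : U -> V -> Prop) :
    (forall u, exists v, L u v) -> (forall v, L 0 v -> v = 0) ->
    (forall a u u' v v', L u v -> L u' v' -> L (a *: u + u') (a *: v + v')) ->
  exists f : {linear U -> V}, forall u, L u (f u).
Proof.
move=> /choice[f fP] L0 Llin.
have Luniq u v v' : L u v -> L u v' -> v = v'.
  move=> uv uv'; have := Llin (-1) _ _ _ _ uv uv'.
  by rewrite !scaleN1r addNr => /L0/eqP; rewrite addrC subr_eq0 => /eqP.
have flin : linear f by move=> a u v; apply: Luniq (fP _) (Llin _ _ _ _ _ _ _).
pose fl := GRing.isLinear.Build R U V _ f flin.
by exists (HB.pack f fl : {linear U -> V}).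
Qed.

Lemma linear_factor_surj M N A (p : {linear M -> N}) (g : {linear M -> A}) :
    (forall y, exists x, p x = y) -> (forall x, p x = 0 -> g x = 0) ->
  exists h : {linear N -> A}, forall x, h (p x) = g x.
Proof.
move=> p_surj pg.
have [|v [x [/pg] ? <-]//|a _ _ _ _ [x [<- <-]] [y [<- <-]]|h hP] :=
  @linear_unique_choice N A (fun y z => exists x, p x = y /\ g x = z).
- by move=> y; have [x <-] := p_surj y; exists (g x), x.
- by exists (a *: x + y); rewrite !linearP.
exists h => x; have [y [pxy <-]] := hP (p x).
by apply/eqP; rewrite -subr_eq0 -linearB pg// linearB /= pxy subrr.
Qed.

End Linear.

(** * Maps out of a right resolution *)

Section Coresolutions.
Variables (R : pzRingType) (X : lmodType R -> Prop).
Implicit Types M A : lmodType R.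

(** For [A] in [X] this spells out, degree by degree, the exactness of
    [... -> Hom(C (n - 1), A) -> Hom(C n, A) -> Hom(M, A) -> 0].
    The equations between degrees are hypotheses, so that the property survives a
    shift, where [i - n = (j - n) + 1] does not hold by computation. *)
Record coresolution (M : lmodType R) (n : int) (C : complex R)
    (eta : {linear M -> C n}) : Prop := Coresolution {
  cores_above : forall i, n < i -> forall x : C i, x = 0;
  cores_cycle : forall j x, diff C n j (eta x) = 0;
  cores_extend : forall A, X A -> forall f : {linear M -> A},
    exists g : {linear C n -> A}, forall x, g (eta x) = f x;
  cores_factor0 : forall A, X A -> forall k, n = k + 1 -> forall g : {linear C n -> A},
    (forall x, g (eta x) = 0) ->
    exists h : {linear C k -> A}, forall x, h (diff C n k x) = g x;
  cores_factor : forall A, X A -> forall i j k, i = j + 1 -> j = k + 1 -> j < n ->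
    forall g : {linear C j -> A}, (forall x, g (diff C i j x) = 0) ->
    exists h : {linear C k -> A}, forall x, h (diff C j k x) = g x }.

(** A map killed by the incoming differential factors through the cokernel of the
    previous preenvelope, and then extends along the next preenvelope. *)
Lemma right_resolution_coresolution M (Y : complex R) (n : int) :
  is_right_resolution X M Y -> n = 0 ->
  exists eta : {linear M -> Y n}, coresolution eta.
Proof.
move=> [Y_above [C [phi0 [phi [p]]]]] [[phi0_pre phi_pre] [p0_coker p_coker] dE] n0.
have {n0} -> : n = - 0%:Z by lia.
exists phi0.
have p_surj m : forall c, exists y, p m y = c.
  by case: m => [|m]; [exact: p0_coker.1|exact: (p_coker m).1].
split=> //.
- move=> j x; have [->|nj] := eqVneq j (- 1%:Z).
    by rewrite dE (p0_coker.2 _).2 ?linear0//; exists x.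
  by apply: diff_shape; move: nj; apply: contra => /eqP; lia.
- by move=> A XA f; have [_ /(_ A f XA)] := phi0_pre.
- move=> A XA k nk; have {nk} -> : k = - 1%:Z by lia.
  move=> g g0.
  have [x /p0_coker.2[y <-]//|g' g'P] := linear_factor_surj p0_coker.1 (g := g).
  have [_ /(_ A g' XA)[h hP]] := phi_pre 0%N.
  by exists h => x; rewrite dE hP.
move=> A XA i j k ij jk jn.
have [m jm] : exists m, j = - m.+1%:Z by exists `|j|%N.-1; lia.
have {}ij : i = - m%:Z by lia.
have {}jk : k = - m.+2%:Z by lia.
subst=> g g0; have [x /(p_coker m).2[y <-]|g' g'P] := linear_factor_surj (p_coker m).1 (g := g).
  by have [z <-] := p_surj m y; rewrite -dE.
have [_ /(_ A g' XA)[h hP]] := phi_pre m.+1.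
by exists h => x; rewrite dE hP.
Qed.

(** The shifted differential is the old one up to sign, and a factorization through
    [d] gives one through [- d] by negating the second factor. *)
Lemma shift_coresolution M (Y : complex R) (m n : int) (eta : {linear M -> Y (m - n)}) :
  coresolution eta -> @coresolution M m (shift n Y) eta.
Proof.
move=> [above cycle ext fac0 fac].
have sgn : (-1 : int) ^ n = 1 \/ (-1 : int) ^ n = -1.
  by case: n {eta above cycle ext fac0 fac} => k; rewrite ?NegzE -?exprnN -?exprnP
    -signr_odd; case: odd; rewrite ?invr1 ?invrN1; [right|left|right|left].
have shift_factor A i j (f : {linear Y (i - n) -> A}) :
    (exists h : {linear Y (j - n) -> A}, forall x, h (diff Y (i - n) (j - n) x) = f x) ->
    exists h : {linear Y (j - n) -> A}, forall x, h (diff (shift n Y) i j x) = f x.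
  move=> [h hP]; rewrite /= /shift_diff; case: sgn => ->.
    by exists h => x; rewrite mulr1z hP.
  by exists (\- h) => x /=; rewrite mulrN1z linearN opprK hP.
split=> //.
- by move=> i mi x; apply: above; lia.
- by move=> j x; rewrite /= /shift_diff cycle mul0rz.
- by move=> A XA k mk g g0; apply: shift_factor; apply: fac0 => //; lia.
move=> A XA i j k ij jk jm g g0; apply: shift_factor.
apply: (fac A XA (i - n)) => //; try lia.
move=> x; have := g0 x; rewrite /= /shift_diff.
by case: sgn => ->; rewrite ?mulr1z// mulrN1z linearN => /eqP; rewrite oppr_eq0 => /eqP.
Qed.

Section Comparison.
Variables (M : lmodType R) (n : int) (C Y : complex R) (eta : {linear M -> C n}).
Hypotheses (eta_cores : coresolution eta) (XY : forall i, X (Y i)).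

(** The component in degree [n] comes from [cores_extend]. If the components down to
    degree [k + 1] commute with the differentials, then [d \o F (k + 1)] kills the
    image of the incoming map, hence factors through [C (k + 1) -> C k]. *)
Lemma coresolution_extend_cycle (f : {linear M -> Y n}) :
  (forall x, diff Y n (n - 1) (f x) = 0) ->
  exists F : chain_map C Y, forall x, F n (eta x) = f x.
Proof.
move=> f_cycle; have [g geta] := cores_extend eta_cores (XY n) f.
pose T i : Type := {linear C i -> Y i}.
pose F0 : forall i, T i := dfwith (T := T) (fun i => \0) g.
pose Q k (F : forall i, T i) :=
  forall i, i = k + 1 -> forall x : C i, F k (diff C i k x) = diff Y i k (F i x).
have [k F F' FF' QF i ik x|k nk i ik x|k F kn FF0 QF|F [QF FF0]] :=
  @downward_extension _ Q n F0.
- by rewrite -!FF' ?QF//; lia.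
- by rewrite (cores_above eta_cores (i := i) _ x) ?linear0//; lia.
- pose dF := diff Y (k + 1) k \o F (k + 1).
  suff [h hP] : exists h : {linear C k -> Y k}, forall x, h (diff C (k + 1) k x) = dF x.
    exists h => i ik; subst i => x.
    by rewrite dfwith_in hP dfwith_out//; apply/eqP; lia.
  have [nk|nk] := eqVneq n (k + 1).
    rewrite {}/dF -nk FF0// /F0 dfwith_in.
    apply: (cores_factor0 eta_cores) => // x /=.
    by rewrite geta; have := f_cycle x; have -> : n - 1 = k by lia.
  apply: (cores_factor eta_cores (XY _) (i := k + 1 + 1)) => //; first by lia.
  by move=> x /=; rewrite (QF (k + 1))// ?diff_diff//; lia.
have Fdiff i j x : F j (diff C i j x) = diff Y i j (F i x).
  have [/QF->//|ij] := eqVneq i (j + 1).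
  by rewrite !diff_shape ?linear0.
by exists (ChainMap Fdiff) => x /=; rewrite FF0// /F0 dfwith_in.
Qed.

(** Extending the bounding map [g] along [eta] gives the homotopy in degree [n]. Once
    [h] is known down to degree [i = k + 1], the map [F i - d \o h i] kills the image of
    the incoming map, so it factors through [C i -> C k], which provides [h k]. *)
Lemma coresolution_null_homotopic (F : chain_map C Y) :
  F \in @null_homotopic R C Y <->
  exists g : {linear M -> Y (n + 1)}, forall x, diff Y (n + 1) n (g x) = F n (eta x).
Proof.
split=> [/null_homotopicP[h hP]|[f fP]].
  exists (h n (n + 1) \o eta) => x /=.
  by rewrite hP (cores_cycle eta_cores) linear0 addr0.
have [g geta] := cores_extend eta_cores (XY (n + 1)) f.
(* A homotopy has a component for each pair of degrees; all components with the same
   source are treated as one unknown, and only the one of degree [1] matters. *)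
pose T i : Type := forall j, {linear C i -> Y j}.
pose h0 : forall i, T i := dfwith (T := T) (fun i j => \0)
  (dfwith (T := fun j => {linear C n -> Y j}) (fun j => \0) g).
pose Q k (h : forall i, T i) := forall i j, i = k + 1 -> j = i + 1 -> forall x : C i,
  F i x = diff Y j i (h i j x) + h k i (diff C i k x).
have [k h h' hh' Qh i j ik ji x|k nk i j ik ji x|k h kn hh0 Qh|h [Qh _]] :=
  @downward_extension _ Q n h0.
- by rewrite -!hh' ?(Qh i j)//; lia.
- by rewrite (cores_above eta_cores (i := i) _ x) ?linear0 ?addr0//; lia.
- have [i ik] : exists i, i = k + 1 by exists (k + 1).
  pose dh := F i \- (diff Y (i + 1) i \o h i (i + 1)).
  suff [s sP] : exists s : {linear C k -> Y i}, forall x, s (diff C i k x) = dh x.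
    exists (dfwith (T := fun j => {linear C k -> Y j}) (fun j => \0) s).
    move=> i' j; rewrite -ik => -> -> x; rewrite !dfwith_in sP dfwith_out; last by apply/eqP; lia.
    by rewrite /dh /= [RHS]addrC subrK.
  have [ni|ni] := eqVneq n i.
    rewrite {}/dh; case: _ / ni in ik *; apply: (cores_factor0 eta_cores) => // x /=.
    by rewrite hh0// /h0 !dfwith_in geta fP subrr.
  apply: (cores_factor eta_cores (XY _) (i := i + 1)) => //; try lia.
  move=> x /=; rewrite cmap_diff (Qh i _ (i + 1) (i + 1 + 1))//; last by lia.
  by rewrite linearD diff_diff add0r subrr.
apply/null_homotopicP; exists h => i x.
by rewrite (Qh (i - 1) i (i + 1))// subrK.
Qed.

End Comparison.

End Coresolutions.

(** * Direct sums of modules and of complexes *)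

Section DirectSums.
Variables (R : pzRingType) (I : choiceType).

Record dsum (A : I -> lmodType R) := Dsum {
  dval :> forall i, A i;
  dval_finite : finite_set [set i | dval i != 0]
}.

Section Module.
Variable A : I -> lmodType R.
Implicit Types x y : dsum A.

Lemma dsum_ext x y : (forall i, x i = y i) -> x = y.
Proof.
case: x y => x xf [y yf] /= xyi.
have xy : x = y by apply: functional_extensionality_dep.
by case: _ / xy in yf *; rewrite (Prop_irrelevance xf yf).
Qed.

HB.instance Definition _ := gen_eqMixin (dsum A).
HB.instance Definition _ := gen_choiceMixin (dsum A).

Fact dsum_add_finite x y : finite_set [set i | x i + y i != 0].
Proof.
apply: (@sub_finite_set _ _ ([set i | x i != 0] `|` [set i | y i != 0])).
  move=> i /=; have [->|] := eqVneq (x i) 0; last by left.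
  by rewrite add0r; right.
by rewrite finite_setU; split; apply: dval_finite.
Qed.
Fact dsum_zero_finite : finite_set [set i | 0 != 0 :> A i].
Proof. by apply: sub_finite_set (finite_set0 I) => i /=; rewrite eqxx. Qed.
Fact dsum_opp_finite x : finite_set [set i | - x i != 0].
Proof. by apply: sub_finite_set (dval_finite x) => i /=; rewrite oppr_eq0. Qed.
Fact dsum_scale_finite (a : R) x : finite_set [set i | a *: x i != 0].
Proof.
apply: sub_finite_set (dval_finite x) => i /=.
by apply: contra => /eqP->; rewrite scaler0.
Qed.

Definition dsum_add x y := Dsum (dsum_add_finite x y).
Definition dsum_zero := Dsum dsum_zero_finite.
Definition dsum_opp x := Dsum (dsum_opp_finite x).
Definition dsum_scale a x := Dsum (dsum_scale_finite a x).

Fact dsum_addA : associative dsum_add.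
Proof. by move=> x y z; apply: dsum_ext => i /=; rewrite addrA. Qed.
Fact dsum_addC : commutative dsum_add.
Proof. by move=> x y; apply: dsum_ext => i /=; rewrite addrC. Qed.
Fact dsum_add0 : left_id dsum_zero dsum_add.
Proof. by move=> x; apply: dsum_ext => i /=; rewrite add0r. Qed.
Fact dsum_addN : left_inverse dsum_zero dsum_opp dsum_add.
Proof. by move=> x; apply: dsum_ext => i /=; rewrite addNr. Qed.

HB.instance Definition _ := GRing.isZmodule.Build (dsum A)
  dsum_addA dsum_addC dsum_add0 dsum_addN.

Fact dsum_scaleA a b x : dsum_scale a (dsum_scale b x) = dsum_scale (a * b) x.
Proof. by apply: dsum_ext => i /=; rewrite scalerA. Qed.
Fact dsum_scale1 : left_id 1 dsum_scale.
Proof. by move=> x; apply: dsum_ext => i /=; rewrite scale1r. Qed.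
Fact dsum_scaleDr : right_distributive dsum_scale +%R.
Proof. by move=> a x y; apply: dsum_ext => i /=; rewrite scalerDr. Qed.
Fact dsum_scaleDl x : {morph dsum_scale^~ x : a b / a + b}.
Proof. by move=> a b; apply: dsum_ext => i /=; rewrite scalerDl. Qed.

HB.instance Definition _ := GRing.Zmodule_isLmodule.Build R (dsum A)
  dsum_scaleA dsum_scale1 dsum_scaleDr dsum_scaleDl.

Definition dsum_proj i x : A i := x i.
Fact dsum_proj_linear i : linear (@dsum_proj i).
Proof. by []. Qed.
HB.instance Definition _ i :=
  GRing.isLinear.Build R (dsum A) (A i) _ (@dsum_proj i) (@dsum_proj_linear i).

Fact dsum_inj_finite i (a : A i) : finite_set [set j | dfwith (fun j => 0 : A j) a j != 0].
Proof.
apply: sub_finite_set (finite_set1 i) => j /=.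
by have [<-//|ij] := eqVneq i j; rewrite dfwith_out ?eqxx.
Qed.
Definition dsum_inj i (a : A i) : dsum A := Dsum (dsum_inj_finite a).
Fact dsum_inj_linear i : linear (@dsum_inj i).
Proof.
move=> a x y; apply: dsum_ext => j /=.
have [ij|ij] := eqVneq i j; last by rewrite !dfwith_out// scaler0 addr0.
by case: _ / ij; rewrite !dfwith_in.
Qed.
HB.instance Definition _ i :=
  GRing.isLinear.Build R (A i) (dsum A) _ (@dsum_inj i) (@dsum_inj_linear i).

Section Copairing.
Variables (N : lmodType R) (f : forall i, {linear A i -> N}).

Definition dsum_copair x : N := \sum_(i \in [set: I]) f i (x i).

(** The sum over all of [I] may be taken over any finite set containing the support;
    this allows several elements to share one index set. *)
Lemma dsum_copairE (D : set I) x : finite_set D -> (forall i, x i != 0 -> D i) ->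
  dsum_copair x = \sum_(i <- fset_set D) f i (x i).
Proof.
move=> Dfin xD; apply: fsbigTE => i; rewrite in_fset_set// => iD.
have [->|/xD Di] := eqVneq (x i) 0; first by rewrite linear0.
by case/negP: iD; apply: mem_set.
Qed.

Fact dsum_copair_linear : linear dsum_copair.
Proof.
move=> a x y; pose D := [set i | x i != 0] `|` [set i | y i != 0].
have Dfin : finite_set D by rewrite finite_setU; split; apply: dval_finite.
have xD i : x i != 0 -> D i by left.
have yD i : y i != 0 -> D i by right.
have xyD i : (a *: x + y) i != 0 -> D i.
  have [xi|/xD//] := eqVneq (x i) 0; have [yi|/yD//] := eqVneq (y i) 0.
  by rewrite /= xi yi scaler0 addr0 eqxx.
rewrite (dsum_copairE Dfin xD) (dsum_copairE Dfin yD) (dsum_copairE Dfin xyD).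
by rewrite scaler_sumr -big_split; apply: eq_bigr => i _; rewrite linearP.
Qed.
HB.instance Definition _ :=
  GRing.isLinear.Build R (dsum A) N _ dsum_copair dsum_copair_linear.

Lemma dsum_copair_inj i (a : A i) : dsum_copair (dsum_inj a) = f i a.
Proof.
rewrite (dsum_copairE (D := [set i])) ?fset_set1 ?big_seq_fset1 /= ?dfwith_in//.
by move=> j /=; have [<-//|ij] := eqVneq i j; rewrite dfwith_out ?eqxx.
Qed.

End Copairing.

Lemma dsum_expand (D : set I) x : finite_set D -> (forall i, x i != 0 -> D i) ->
  x = \sum_(i <- fset_set D) dsum_inj (x i).
Proof.
move=> Dfin xD; apply: dsum_ext => j; rewrite -[RHS]/(dsum_proj j _) linear_sum/=.
have sumE : \sum_(i <- fset_set D) dsum_proj j (dsum_inj (x i)) =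
    \sum_(i <- fset_set D | i == j) dsum_proj j (dsum_inj (x i)).
  rewrite [RHS]big_mkcond; apply: eq_bigr => i _.
  by case: eqVneq => // ij; rewrite /dsum_proj/= dfwith_out.
rewrite sumE; have [jD|jD] := boolP (j \in fset_set D).
  by rewrite -big_filter filter_pred1_uniq// big_seq1 /dsum_proj/= dfwith_in.
rewrite big1_seq => [|i /andP[/eqP->]]; last by move/negP: jD.
by apply/eqP; apply: contraNT jD => /xD Dj; rewrite in_fset_set// mem_set.
Qed.

Lemma dsum_is_direct_sum :
  @is_direct_sum R I A (dsum A) (fun i => @dsum_inj i : {linear A i -> dsum A}).
Proof.
move=> N f; exists (dsum_copair f); split=> [i a|g gf x].
  exact: dsum_copair_inj.
rewrite [x in LHS](dsum_expand (dval_finite x))// linear_sum.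
by rewrite /= (dsum_copairE f (dval_finite x))//; apply: eq_bigr => i _; exact: gf.
Qed.

Lemma dsum_Add (X : lmodType R -> Prop) : (forall i, X (A i)) -> Add X (dsum A).
Proof.
move=> XA; exists I, A, (dsum A), (fun i => @dsum_inj i : {linear A i -> dsum A}), 'rV[R]_0.
split=> //; first exact: dsum_is_direct_sum.
have pair_lin : linear (fun x => (x, 0) : (dsum A * 'rV[R]_0)%type).
  by move=> a x y; apply/pair_equal_spec; split; rewrite //= scaler0 addr0.
pose pair := GRing.isLinear.Build R _ _ _ _ pair_lin.
exists fst, (HB.pack (fun x => (x, 0) : (dsum A * 'rV[R]_0)%type) pair :
  {linear dsum A -> (dsum A * 'rV[R]_0)%type}).
by split=> // -[x y] /=; rewrite [y]thinmx0.
Qed.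

End Module.

Section Map.
Variables (A B : I -> lmodType R) (f : forall i, {linear A i -> B i}).

Fact dsum_map_finite (x : dsum A) : finite_set [set i | f i (x i) != 0].
Proof.
apply: sub_finite_set (dval_finite x) => i /=.
by apply: contra => /eqP->; rewrite linear0.
Qed.
Definition dsum_map x : dsum B := Dsum (dsum_map_finite x).
Fact dsum_map_linear : linear dsum_map.
Proof. by move=> a x y; apply: dsum_ext => i /=; rewrite linearP. Qed.
HB.instance Definition _ :=
  GRing.isLinear.Build R (dsum A) (dsum B) _ dsum_map dsum_map_linear.

End Map.

Section Complexes.
Variable A : I -> complex R.

Fact dsum_diff_shape i j : i != j + 1 ->
  forall x, dsum_map (fun t => diff (A t) i j) x = 0.
Proof. by move=> ij x; apply: dsum_ext => t /=; rewrite diff_shape. Qed.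
Fact dsum_diff_diff i j k x :
  dsum_map (fun t => diff (A t) j k) (dsum_map (fun t => diff (A t) i j) x) = 0.
Proof. by apply: dsum_ext => t /=; rewrite diff_diff. Qed.

Definition dsum_complex : complex R :=
  @Complex R (fun i => dsum (fun t => A t i)) (fun i j => dsum_map (fun t => diff (A t) i j))
    dsum_diff_shape dsum_diff_diff.

Fact dsum_cm_inj_diff t i j x :
  dsum_inj (diff (A t) i j x) = diff dsum_complex i j (dsum_inj x).
Proof.
apply: dsum_ext => s /=; have [ts|ts] := eqVneq t s.
  by case: _ / ts; rewrite !dfwith_in.
by rewrite !dfwith_out// linear0.
Qed.
Definition dsum_cm_inj t : chain_map (A t) dsum_complex :=
  @ChainMap R (A t) dsum_complex
    (fun i => @dsum_inj (fun t => A t i) t) (@dsum_cm_inj_diff t).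

Definition dsum_cm_proj t : chain_map dsum_complex (A t) :=
  @ChainMap R dsum_complex (A t)
    (fun i => @dsum_proj (fun t => A t i) t) (fun i j x => erefl).

Section Copairing.
Variables (Y : complex R) (f : forall t, chain_map (A t) Y).

Fact dsum_cm_copair_diff i j x :
  dsum_copair (fun t => f t j) (diff dsum_complex i j x) =
  diff Y i j (dsum_copair (fun t => f t i) x).
Proof.
rewrite !(dsum_copairE _ (dval_finite x))//.
  by rewrite linear_sum; apply: eq_bigr => t _ /=; rewrite cmap_diff.
by move=> t; apply: contraNN => /eqP /= ->; rewrite linear0.
Qed.
Definition dsum_cm_copair : chain_map dsum_complex Y :=
  @ChainMap R dsum_complex Y
    (fun i => dsum_copair (fun t => f t i)) dsum_cm_copair_diff.

Lemma dsum_cm_copair_inj t : cm_comp dsum_cm_copair (dsum_cm_inj t) = f t.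
Proof. by apply: chain_map_ext => i x /=; rewrite dsum_copair_inj. Qed.

End Copairing.
End Complexes.
End DirectSums.

(** * Coproducts in a preadditive category *)

Section Preadditive.
Variable T : preadditive.

Lemma cmp0r (A B C : T) (g : hom B C) : cmp g (0 : hom A B) = 0.
Proof. by apply: (addrI (cmp g 0)); rewrite -cmpDr !addr0. Qed.

Lemma cmp0l (A B C : T) (f : hom A B) : cmp (0 : hom B C) f = 0.
Proof. by apply: (addrI (cmp 0 f)); rewrite -cmpDl !addr0. Qed.

Lemma cmp_sumr (A B C : T) (g : hom B C) (I : Type) (s : seq I) (f : I -> hom A B) :
  cmp g (\sum_(i <- s) f i) = \sum_(i <- s) cmp g (f i).
Proof. exact: (big_morph _ (cmpDr g) (cmp0r A g)). Qed.

Section Coproduct.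
Variables (I : choiceType) (A : I -> T) (S : T) (inj : forall i, hom (A i) S).
Hypothesis S_coprod : is_coproduct inj.

Lemma coproduct_epi (B : T) (g h : hom S B) :
  (forall i, cmp g (inj i) = cmp h (inj i)) -> g = h.
Proof.
move=> gh; have [k [_ k_uniq]] := S_coprod (fun i => cmp h (inj i)).
by rewrite -(k_uniq g)// -(k_uniq h).
Qed.

(** The universal property applied to the family that is the identity at [j] and zero
    elsewhere. *)
Lemma coproduct_projections : exists pr : forall j, hom S (A j),
  forall j, cmp (pr j) (inj j) = idm (A j) /\
            (forall i, i != j -> cmp (pr j) (inj i) = 0).
Proof.
suff /(_ _)/cid pr_ex j : exists p : hom S (A j), cmp p (inj j) = idm (A j) /\
    (forall i, i != j -> cmp p (inj i) = 0).
  by exists (fun j => sval (pr_ex j)) => j; case: (pr_ex j).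
have [p [pP _]] := S_coprod
  (dfwith (T := fun i => hom (A i) (A j) : Type) (fun i => 0) (idm (A j))).
exists p; split=> [|i ij]; first by rewrite pP dfwith_in.
by rewrite pP dfwith_out// eq_sym.
Qed.

(** The projections recover the coordinates, so this half of compactness holds for
    every object of every preadditive category. *)
Lemma coproduct_sum_inj (C : T) (f f' : forall i, hom C (A i)) :
  finite_set [set i | f i != 0] -> finite_set [set i | f' i != 0] ->
  \sum_(i \in [set: I]) cmp (inj i) (f i) = \sum_(i \in [set: I]) cmp (inj i) (f' i) ->
  f = f'.
Proof.
have [pr prP] := coproduct_projections.
have coord (g : forall i, hom C (A i)) j : finite_set [set i | g i != 0] ->
    cmp (pr j) (\sum_(i \in [set: I]) cmp (inj i) (g i)) = g j.
  move=> gfin; pose D := [set i | g i != 0] `|` [set j].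
  have Dfin : finite_set D by rewrite finite_setU.
  rewrite (fsbigTE (fset_set D)) => [|i]; last first.
    rewrite in_fset_set// => /negP iD; have [->|gi] := eqVneq (g i) 0; first by rewrite cmp0r.
    by case: iD; apply: mem_set; left.
  rewrite cmp_sumr (big_fsetD1 j) ?in_fset_set//=; last by apply: mem_set; right.
  rewrite cmpA (prP j).1 cmp1m big1_seq ?addr0// => i; rewrite !inE => /andP[_ /andP[ij _]].
  by rewrite cmpA (prP j).2// cmp0l.
move=> ffin f'fin ff'; apply: functional_extensionality_dep => j.
by rewrite -(coord f)// ff' coord.
Qed.

End Coproduct.
End Preadditive.

(** * Homotopy classes and compactness *)

Section HomotopyClasses.
Variable R : pzRingType.

Lemma hclass_eq0 (Y Z : complex R) (F : chain_map Y Z) :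
  hclass F = 0 <-> F \in @null_homotopic R Y Z.
Proof.
have <- : hclass (0 : chain_map Y Z) = 0 :> hmap Y Z.
  by apply: (addrI (hclass 0)); rewrite -hclassD !addr0.
by split=> [/hclassP|F0]; [|apply/hclassP]; rewrite subr0.
Qed.

Lemma hclass_sum (Y Z : complex R) (I : Type) (s : seq I) (F : I -> chain_map Y Z) :
  \sum_(i <- s) hclass (F i) = hclass (\sum_(i <- s) F i).
Proof.
symmetry; apply: big_morph; first exact: hclassD.
exact/hclass_eq0/rpred0.
Qed.

Lemma chain_map_sumE (Y Z : complex R) (I : Type) (s : seq I)
    (F : I -> chain_map Y Z) k (y : Y k) :
  (\sum_(i <- s) F i) k y = \sum_(i <- s) F i k y.
Proof. exact: (big_morph (fun G : chain_map Y Z => G k y)). Qed.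

(** The supports of the images of finitely many generators cover the supports of all
    elements of the image. *)
Lemma finitely_presented_dsum_finite (I : choiceType) (A : I -> lmodType R)
    (M : lmodType R) (f : {linear M -> dsum A}) : finitely_presented M ->
  exists2 D : set I, finite_set D & forall x i, f x i != 0 -> D i.
Proof.
move=> [_ [n [_ [p [p_surj _]]]]].
pose D := \bigcup_(k in [set: 'I_n]) [set i | f (p 'e_k) i != 0].
exists D.
  by apply: bigcup_finite => [|k _]; [exact: finite_finset|exact: dval_finite].
move=> x i; have [v <-] := p_surj x; apply: contraPP => Di; apply/negP; rewrite negbK.
rewrite (row_sum_delta v) !linear_sum -/(dsum_proj i _) linear_sum/=.
rewrite big1// => k _; rewrite !linearZ_LR/= /dsum_proj.
have -> : f (p 'e_k) i = 0; last by rewrite scaler0.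
by apply: contra_notP Di => /eqP fki; exists k.
Qed.

End HomotopyClasses.

Section Compactness.
Variables (R : pzRingType) (X : lmodType R -> Prop).
Hypothesis X_Add : forall M : lmodType R, X M <-> Add X M.

(** Let [D] be the termwise direct sum. The universal property of [S] gives
    [theta : S -> D]; representatives of the injections of [S] assemble into
    [psi : D -> S], and [psi \o theta] is the identity since it fixes the injections.
    Thus it suffices to decompose [theta u], that is, to compare it with the finite sum
    of its components, and this can be tested on the cycle [M -> D n]. *)
Lemma coresolution_compact (M : lmodType R) n (C : K X) (eta : {linear M -> kcomplex C n}) :
  finitely_presented M -> coresolution X eta -> compact C.
Proof.
move=> Mfp eta_cores I A S inj S_coprod u.
suff [f [ffin fu]] : exists f : forall i, hom C (A i),
    finite_set [set i | f i != 0] /\ \sum_(i \in [set: I]) cmp (inj i) (f i) = u.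
  exists f; split=> // f' [f'fin f'u].
  by apply: (coproduct_sum_inj S_coprod) => //; rewrite fu f'u.
pose D : K X := @KOb R X (dsum_complex (fun i => kcomplex (A i)))
  (fun k => (X_Add _).2 (dsum_Add (fun i => @kterm R X (A i) k))).
pose injD i : hom (A i) D := hclass (dsum_cm_inj (fun i => kcomplex (A i)) i).
pose prD i : hom D (A i) := hclass (dsum_cm_proj (fun i => kcomplex (A i)) i).
have [theta [thetaP _]] := S_coprod D injD.
pose psi : hom D S := hclass (dsum_cm_copair (fun i => repr (inj i))).
have psi_injD i : cmp psi (injD i) = inj i.
  by rewrite /psi /injD /= hclass_cmp dsum_cm_copair_inj /hclass reprK.
have psi_theta : cmp psi theta = idm S.
  by apply: (coproduct_epi S_coprod) => i; rewrite -cmpA thetaP psi_injD cmp1m.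
have [U UE] : exists U : chain_map C D, cmp theta u = hclass U := hclass_surj _.
have [E Efin UD] := finitely_presented_dsum_finite (U n \o eta) Mfp.
pose f i : hom C (A i) := if i \in fset_set E then cmp (prD i) (cmp theta u) else 0.
exists f; split.
  apply: (sub_finite_set _ Efin) => i; rewrite /= /f; case: (boolP (i \in fset_set E)).
    by rewrite in_fset_set// => /set_mem.
  by rewrite eqxx.
rewrite (fsbigTE (fset_set E)) => [|i iE]; last first.
  by rewrite /f (negbTE iE); apply: cmp0r.
have -> : \sum_(i <- fset_set E) cmp (inj i) (f i) =
    cmp psi (\sum_(i <- fset_set E) cmp (injD i) (cmp (prD i) (cmp theta u))).
  rewrite cmp_sumr; apply: eq_big_seq => i iE.
  by rewrite /f iE -psi_injD -!cmpA.
suff -> : \sum_(i <- fset_set E) cmp (injD i) (cmp (prD i) (cmp theta u)) = cmp theta u.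
  by rewrite cmpA psi_theta cmp1m.
have termE i : cmp (injD i) (cmp (prD i) (cmp theta u)) =
    hclass (cm_comp (dsum_cm_inj (fun i => kcomplex (A i)) i) (cm_comp (dsum_cm_proj _ i) U)).
  by rewrite UE [cmp (prD i) _]hclass_cmp [LHS]hclass_cmp.
under eq_bigr do rewrite termE.
rewrite UE hclass_sum; apply/hclassP.
apply/(coresolution_null_homotopic eta_cores (@kterm R X D)); exists \0 => x /=.
rewrite linear0 chain_map_sumE; apply/esym/eqP; rewrite subr_eq0; apply/eqP.
exact/esym/(dsum_expand Efin (UD x)).
Qed.

End Compactness.

(** * Contractible complexes *)

Section Contractible.
Variable R : pzRingType.
Implicit Type Y : complex R.

Lemma contractible_split_exact Y : cm_id Y \in @null_homotopic R Y Y -> split_exact Y.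
Proof.
move=> /null_homotopicP[h hP]; split=> [i y y_cycle|i].
  by exists (h i (i + 1) y); have /= := hP i y; rewrite y_cycle linear0 addr0.
exists (diff Y (i + 1) i \o h i (i + 1)); split=> y /=; first by rewrite diff_diff.
by move=> y_cycle; have /= := hP i y; rewrite y_cycle linear0 addr0 => <-.
Qed.

(** Let [p i] be the given projection of [Y i] onto its cycles. For [y] in [Y i] there is
    exactly one [z] with [d z = p i y] and [p (i + 1) z = 0]: exactness gives a preimage,
    from which its [p]-part is removed, and two solutions differ by a cycle killed by
    [p]. The contracting homotopy is [y |-> z]. *)
Lemma split_exact_contractible Y : split_exact Y -> cm_id Y \in @null_homotopic R Y Y.
Proof.
move=> [Y_exact p_ex]; pose p i := sval (cid (p_ex i)); have pP i := svalP (cid (p_ex i)).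
have p_cycle i y : diff Y i (i - 1) (p i y) = 0 := (pP i).1 y.
have p_id i y : diff Y i (i - 1) y = 0 -> p i y = y := (pP i).2 y.
have h_ex (ij : int * int) : exists h : {linear Y ij.1 -> Y ij.2}, ij.2 = ij.1 + 1 ->
    forall y, diff Y ij.2 ij.1 (h y) = p ij.1 y /\ p ij.2 (h y) = 0.
  case: ij => i j /=; have [->|/eqP ?] := eqVneq j (i + 1); last by exists \0.
  have [y|z [dz pz]|a y y' z z' [dz pz] [dz' pz']|h hP] := @linear_unique_choice R (Y i) (Y (i + 1))
    (fun y z => diff Y (i + 1) i z = p i y /\ p (i + 1) z = 0).
  - have [z zy] := Y_exact i _ (p_cycle i y); exists (z - p (i + 1) z).
    have pz_cycle : diff Y (i + 1) i (p (i + 1) z) = 0.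
      by have := p_cycle (i + 1) z; rewrite addrK.
    by rewrite !linearB/= pz_cycle subr0 zy (p_id _ (p (i + 1) z)) ?p_cycle ?subrr.
  - by rewrite -pz p_id// addrK dz linear0.
  - by rewrite !linearP/= dz dz' pz pz' scaler0 addr0.
  by exists h.
pose h ij := sval (cid (h_ex ij)); have hP ij := svalP (cid (h_ex ij)).
apply/null_homotopicP; exists (fun i j => h (i, j)) => i y /=.
have [/= -> // _] := hP (i, i + 1) erefl y.
(* [w] is the defect of the homotopy equation; it is a cycle and [p i w = 0]. *)
pose w := y - p i y - h (i - 1, i) (diff Y i (i - 1) y).
have [|/= dh ph] := hP (i - 1, i) _ (diff Y i (i - 1) y); first by rewrite /= subrK.
have w_cycle : diff Y i (i - 1) w = 0.
  by rewrite /w !linearB/= p_cycle subr0 dh p_id ?diff_diff ?subrr.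
have /eqP : w = 0.
  by rewrite -(p_id _ _ w_cycle) /w !linearB/= ph subr0 (p_id _ (p i y)) ?p_cycle ?subrr.
by rewrite /w -addrA -opprD subr_eq0 => /eqP.
Qed.

Lemma is_zero_contractible (X : lmodType R -> Prop) (Y : K X) :
  is_zero Y <-> cm_id (kcomplex Y) \in @null_homotopic R Y Y.
Proof.
split=> [/(_ Y)[/(_ (idm Y) 0) id0 _]|/hclass_eq0 id0]; first exact/hclass_eq0.
have {}id0 : idm Y = 0 by [].
by move=> Z; split=> f g; [rewrite -[f]cmpm1 -[g]cmpm1|rewrite -[f]cmp1m -[g]cmp1m];
  rewrite id0 ?cmp0r ?cmp0l.
Qed.

End Contractible.

(** * Compactness and generation *)

Theorem mainTheorem1 (R : pzRingType) (X : lmodType R -> Prop)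
    (X_Add : forall M : lmodType R, X M <-> Add X M)
    (res : lmodType R -> K X)
    (resP : forall M : lmodType R, finitely_presented M ->
              is_right_resolution X M (kcomplex (res M)))
    (J : choiceType) (rep : J -> lmodType R) (repP : fp_representatives rep) :
  (forall C : K X, generators rep res C -> compact C) /\
  (generates (generators rep res) <->
   (forall Y : complex R, (forall i : int, X (cterm Y i)) ->
      pure_exact Y -> split_exact Y)).
Proof.
have [rep_fp rep_iso] := repP.
have cores j n : exists eta : {linear rep j -> kcomplex (Kshift n (res (rep j))) n},
    coresolution X eta.
  have [eta eta_cores] := right_resolution_coresolution (resP _ (rep_fp j)) (subrr n).
  by exists eta; apply: shift_coresolution eta_cores.
split=> [_ [j [n ->]]|].
  by have [eta eta_cores] := cores j n; apply: coresolution_compact eta_cores.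
split=> [gen Y XY Y_pure|split_pure Y Y_orth].
  apply/contractible_split_exact/(is_zero_contractible (KOb XY : K X))/gen.
  move=> _ [j [n ->]] f; have [F ->] := hclass_surj f; apply/hclass_eq0.
  have [eta eta_cores] := cores j n.
  apply/(coresolution_null_homotopic eta_cores XY).
  apply: (Y_pure _ (rep_fp j) n (F n \o eta)) => x /=.
  by rewrite -[LHS](cmap_diff F) (cores_cycle eta_cores) linear0.
apply/is_zero_contractible/split_exact_contractible/split_pure => [i|M Mfp n f f_cycle].
  exact: (@kterm R X Y).
have [j [[a [b [ab _]]] _]] := rep_iso M Mfp.
have [eta eta_cores] := cores j n.
have [x|F FE] := coresolution_extend_cycle eta_cores (@kterm R X Y) (f := f \o b).
  exact: f_cycle.
have /hclass_eq0 : hclass F = 0 by apply: Y_orth; exists j, n.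
move=> /(coresolution_null_homotopic eta_cores (@kterm R X Y))[g gP].
by exists (g \o a) => x /=; rewrite gP FE /= ab.
Qed.
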